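(* Let $\{\epsilon_i\}_{i\in\mathbb{Z}}$ be an i.i.d. sequence of standard normal random variables $\epsilon_i\sim\mathcal{N}(0,1)$, and let $\{En_i\}_{i\in\mathbb{Z}}$ be a sequence of real random variables such that: (A1) $\{En_i\}_{i\in\mathbb{Z}}$ is stationary and ergodic; (A2) $\{En_i\}_{i\in\mathbb{Z}}$ is independent of $\{\epsilon_i\}_{i\in\mathbb{Z}}$; (A3) $\mathbb{E}[\log^{+}|En_i|]<\infty$, where $\log^{+}x=\max\{\log x,0\}$. Then the cloud-model recurrence $$X_{n+1}=\epsilon_{n+1}\,|X_n|+En_{n+1},\qquad n\in\mathbb{Z},$$ admits a unique stationary solution $\{X_n\}_{n\in\mathbb{Z}}$.
   Context: Background: a $p$-order (Gaussian) cloud model with numerical characteristics $En_1,\dots,En_p,He$ ($He>0$) generates a cloud drop via $x_1=En_p+He\cdot\epsilon$, $x_i=En_{p-(i-1)}+|x_{i-1}|\cdot\epsilon$ for $2\le i\le p$, with fresh standard normal $\epsilon$ at each step. Viewing the numerical characteristics as a sequence $\{En_i\}$ and the Gaussian noises as a sequence $\{\epsilon_i\}$, this is the stochastic recurrence $X_{n+1}=\epsilon_{n+1}|X_n|+En_{n+1}$ (the characteristics play the role of the additive terms). A stationary solution is a sequence of real random variables $\{X_n\}_{n\in\mathbb{Z}}$ satisfying the recurrence almost surely for all $n$, whose finite-dimensional distributions are shift-invariant; uniqueness is almost sure. *)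

(* Defs.v *)
From HB Require Import structures.
From mathcomp Require Import all_boot all_order all_algebra.
From mathcomp Require Import all_classical all_reals all_analysis.
From mathcomp Require Import normal_distribution.
Set Implicit Arguments. Unset Strict Implicit. Unset Printing Implicit Defensive.
Import Order.TTheory GRing.Theory Num.Theory.
Local Open Scope classical_set_scope.
Local Open Scope ring_scope.

Section defs.
Context {d : measure_display} {T : measurableType d} {R : realType}.
Variable P : probability T R.

Definition is_process (X : int -> T -> R) := forall n, measurable_fun setT (X n).

Definition path (X : int -> T -> R) (w : T) : int -> R := fun i => X i w.

Definition cylinders : set (set (int -> R)) :=
  [set A | exists i (B : set R), measurable B /\ A = [set f | B (f i)]].
Definition prod_measurable (C : set (int -> R)) : Prop := <<s cylinders >> C.

Definition shift (f : int -> R) : int -> R := fun i => f (i + 1).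

(* Stationarity: all finite-dimensional distributions are shift invariant
   (tested on measurable rectangles, which determine them). *)
Definition stationary (X : int -> T -> R) : Prop :=
  forall (n : nat) (idx : 'I_n -> int) (B : 'I_n -> set R) (k : int),
    (forall j, measurable (B j)) ->
    P [set w | forall j, B j (X (idx j) w)] =
    P [set w | forall j, B j (X (idx j + k) w)].

Definition ergodic (X : int -> T -> R) : Prop :=
  forall C : set (int -> R), prod_measurable C -> shift @^-1` C = C ->
    P (path X @^-1` C) = 0%E \/ P (path X @^-1` C) = 1%E.

Definition independent_processes (X Y : int -> T -> R) : Prop :=
  forall C D : set (int -> R), prod_measurable C -> prod_measurable D ->
    P (path X @^-1` C `&` path Y @^-1` D) =
    (P (path X @^-1` C) * P (path Y @^-1` D))%E.

Definition mutually_independent (X : int -> T -> R) : Prop :=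
  forall (n : nat) (idx : 'I_n -> int) (B : 'I_n -> set R),
    injective idx -> (forall j, measurable (B j)) ->
    P [set w | forall j, B j (X (idx j) w)] =
    (\prod_(j < n) P (X (idx j) @^-1` B j))%E.

Definition iid_std_normal (eps : int -> T -> R) : Prop :=
  is_process eps /\ mutually_independent eps /\
  forall i (B : set R), measurable B ->
    P (eps i @^-1` B) = normal_prob 0 1 B.

Definition stationary_solution (eps En X : int -> T -> R) : Prop :=
  is_process X /\ stationary X /\
  {ae P, forall w, forall n : int,
     X (n + 1) w = eps (n + 1) w * `|X n w| + En (n + 1) w}.

End defs.

Definition logplus {R : realType} (x : R) : R := if 1 < x then ln x else 0.

(* Main.v *)
Require Import Defs.
From HB Require Import structures.
From mathcomp Require Import all_boot all_order all_algebra.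
From mathcomp Require Import all_classical all_reals all_analysis.
From mathcomp Require Import measurable_realfun normal_distribution.
From mathcomp Require Import ring lra zify.
Import Order.TTheory GRing.Theory Num.Theory.
Import numFieldNormedType.Exports.
Local Open Scope classical_set_scope.
Local Open Scope ring_scope.

(* Since E|N(0,1)| = sqrt(2/pi) < 1, independence makes the expected Lipschitz
   constant of the m-fold iterated map x |-> eps |x| + En equal to rho^m with
   rho < 1.  By Markov and Borel-Cantelli the Lipschitz constants decay almost
   surely faster than b^(-2m) for some b > 1, while the logarithmic moment of
   the stationary sequence En gives |En_{n-m}| <= b^m eventually.  Hence the
   backward iterations started from 0 at time n-m converge, and the limit X_n is
   one fixed measurable functional of the noise and characteristics translated
   by n, which makes X stationary because the joint law of (En, eps) is
   translation invariant.  Two stationary solutions are, at time n, at distance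
   at most the contraction factor over m steps times a tight quantity, so they
   agree almost surely. *)

(** * Integrals against the image of a weighted measure *)

Section density_transfer.
Import HBNNSimple.
Local Open Scope ereal_scope.
Context d1 d2 (X : measurableType d1) (Y : measurableType d2) (R : realType).
Variables (mu : {measure set X -> \bar R}) (nu : {measure set Y -> \bar R}).
Variables (phi : X -> Y) (W : X -> R).
Hypotheses (mphi : measurable_fun setT phi) (mW : measurable_fun setT W).
Hypothesis W0 : forall x, (0 <= W x)%R.
Hypothesis nuE : forall B, measurable B -> \int[mu]_(x in phi @^-1` B) (W x)%:E = nu B.

(** By [nuE], [nu] is the image under [phi] of the measure with density [W] with respect to [mu];
    the identity passes from indicators to simple functions by linearity, then to [f] by monotone
    convergence. *)
Lemma ge0_integral_density (f : Y -> \bar R) :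
  measurable_fun setT f -> (forall y, 0 <= f y) ->
  \int[mu]_x ((W x)%:E * f (phi x)) = \int[nu]_y f y.
Proof.
move=> mf f0; pose f_ := nnsfun_approx measurableT mf.
have mindic (B : set Y) : measurable B ->
    measurable_fun setT (fun x => (\1_B (phi x))%:E : \bar R).
  by move=> mB; apply/measurable_EFinP; apply: measurableT_comp.
have cvg_f_ y : (f_ n y)%:E @[n --> \oo] --> f y.
  by apply: cvg_nnsfun_approx => // *; exact: f0.
have f_nd y m n : (m <= n)%N -> (f_ m y <= f_ n y)%R.
  by move=> mn; exact/lefP/nd_nnsfun_approx.
transitivity (limn (fun n => \int[mu]_x ((W x)%:E * (f_ n (phi x))%:E))).
  rewrite -monotone_convergence//.
  - apply: eq_integral => x _; apply/esym/cvg_lim => //.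
    exact: cvgeZl.
  - move=> n; apply: emeasurable_funM; first exact/measurable_EFinP.
    by apply/measurable_EFinP; apply: measurableT_comp.
  - by move=> n y _; rewrite mule_ge0// lee_fin.
  - by move=> x _ m n mn; apply: lee_wpmul2l; rewrite lee_fin //; exact: f_nd.
transitivity (limn (fun n => \int[nu]_y (f_ n y)%:E)); last first.
  rewrite -monotone_convergence//.
  - by apply: eq_integral => y _; exact/cvg_lim.
  - by move=> n; apply/measurable_EFinP.
  - by move=> n y _; rewrite lee_fin.
  - by move=> y _ m n mn; rewrite lee_fin; exact: f_nd.
congr (limn _); apply/funext => n.
under eq_integral => x _.
  rewrite fimfunE -fsumEFin// ge0_mule_fsumr; last first.
    by move=> r; rewrite EFinM nnfun_muleindic_ge0.
  over.
rewrite ge0_integral_fsum//; last 2 first.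
- move=> r; apply: emeasurable_funM; first exact/measurable_EFinP.
  under eq_fun do rewrite EFinM.
  by apply: emeasurable_funM => //; exact: mindic.
- move=> r x _; apply: mule_ge0; first by rewrite lee_fin.
  by rewrite EFinM nnfun_muleindic_ge0.
under [RHS]eq_integral do rewrite fimfunE -fsumEFin//.
rewrite ge0_integral_fsum//; last 2 first.
- by move=> r; exact/measurable_EFinP/measurable_funM.
- by move=> r x _; rewrite EFinM nnfun_muleindic_ge0.
apply: eq_fsbigr => r _.
rewrite integralZl_indic_nnsfun// integral_indic// setIT.
(* A negative [r] has an empty fibre under the nonnegative [f_ n], so both sides vanish; a
   nonnegative [r] can be pulled out of the integral. *)
have [r0|r0] := ltP r 0%R.
  rewrite preimage_nnfun0// measure0 mule0 integral0_eq// => x _.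
  by rewrite indic0 mulr0 mule0.
under eq_integral => x _ do rewrite EFinM muleCA.
rewrite ge0_integralZl//; last 2 first.
- by apply: emeasurable_funM; [exact/measurable_EFinP|exact: mindic].
- by move=> x _; rewrite mule_ge0// lee_fin.
rewrite -nuE//; congr (_ * _); rewrite [RHS]integral_mkcond.
apply: eq_integral => x _; rewrite patchE indicE.
have [h|h] := pselect (f_ n (phi x) = r).
  by rewrite !mem_set//= mule1.
by rewrite !memNset//= mule0.
Qed.
End density_transfer.

(** * First absolute moment of the standard normal law *)

Section normal_abs.
Context {R : realType}.
Local Notation mu := lebesgue_measure.

(** If pi were 2, then cos 1 = cos (pi/2) = 0, although cos 1 > 0. The strict inequality is what
    makes sqrt(2/pi) smaller than 1. *)
Lemma pi_gt2 : 2 < pi :> R.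
Proof.
rewrite lt_neqAle pi_ge2 andbT; apply/eqP => pi2.
by have := @cos1_gt0 R; rewrite -(@divff R 2)// {1}pi2 cos_pihalf ltxx.
Qed.

Lemma ge0_integral_normal_prob m (s : R) (f : R -> \bar R) :
  measurable_fun setT f -> (forall x, 0 <= f x)%E ->
  (\int[normal_prob m s]_x f x = \int[mu]_x ((normal_pdf m s x)%:E * f x))%E.
Proof.
move=> mf f0; apply/esym.
apply: (@ge0_integral_density _ _ _ _ _ mu (normal_prob m s) id
  (normal_pdf m s)) => //.
- exact: measurable_normal_pdf.
- exact: normal_pdf_ge0.
Qed.

Lemma normal_pdf01 (x : R) :
  normal_pdf 0 1 x = normal_peak 1 * expR (- (x ^+ 2 / 2)).
Proof.
by rewrite normal_pdfE ?oner_neq0// /normal_fun subr0 expr1n mulNr mulr2n.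
Qed.

(** The integrand is the derivative of minus the density, which vanishes at infinity, so the
    integral is the density at 0. *)
Lemma integral0y_normal :
  (\int[mu]_(x in `[0%R, +oo[) (x * normal_pdf 0 1 x)%:E = (normal_peak 1 : R)%:E)%E.
Proof.
pose F (x : R) := - (normal_peak 1 * expR (- (x ^+ 2 / 2))).
have dF (x : R) : is_derive x 1 F (x * normal_pdf 0 1 x).
  rewrite /F; apply: is_derive_eq; rewrite normal_pdf01 /GRing.scale/=; by field.
rewrite (@ge0_continuous_FTC2y _ _ F _ 0).
- by rewrite /F expr0n/= mul0r oppr0 expR0 mulr1 -EFinB opprK add0r.
- by move=> x x0; rewrite mulr_ge0// normal_pdf_ge0.
- apply: continuous_subspaceT => x.
  by apply: cvgM; [exact: cvg_id|apply: continuous_normal_pdf; rewrite oner_neq0].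
- rewrite /F -oppr0 -(mulr0 (normal_peak 1)).
  apply: cvgN; apply: cvgM; first exact: cvg_cst.
  apply: (cvg_comp (fun x : R => x ^+ 2 / 2) (fun x => expR (- x))).
    by apply: gt0_cvgMly; [rewrite invr_gt0|exact: cvgr_expr2].
  exact: cvgr_expR.
- by move=> x _; have [] := dF x.
- apply/cvg_at_right_filter; apply: differentiable_continuous.
  by apply/derivable1_diffP; have [] := dF 0.
- by move=> x _; rewrite derive1E derive_val.
Qed.

Lemma integral_normal_abs :
  exists2 rho : R, 0 < rho < 1 &
  (\int[normal_prob (0:R) 1]_x `|x|%:E = rho%:E)%E.
Proof.
(* By evenness the moment is twice the half-line integral. The value is sqrt(2/pi), and squaring
   reduces the bound by 1 to pi > 2. *)
exists (2 * normal_peak 1).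
  rewrite mulr_gt0 ?normal_peak_gt0 ?oner_neq0//=.
  rewrite /normal_peak expr1n mul1r ltr_pdivrMr ?mul1r; last first.
    by rewrite sqrtr_gt0 mulrn_wgt0// pi_gt0.
  rewrite -(ltr_pXn2r (n:=2)) ?nnegrE ?sqrtr_ge0//.
  have pi2 : 0 <= pi *+ 2 :> R by rewrite -mulr_natr mulr_ge0 ?pi_ge0.
  rewrite sqr_sqrtr//.
  by have := pi_gt2; lra.
have mabs : measurable_fun setT (fun x : R => `|x|%:E : \bar R).
  by apply/measurable_EFinP; exact: normr_measurable.
rewrite ge0_integral_normal_prob//.
under eq_integral do rewrite -EFinM.
rewrite ge0_symfun_integralT.
- rewrite EFinM -integral0y_normal -set_itvcy; congr (_ * _)%E.
  apply: eq_integral => x; rewrite inE/= in_itv/= andbT => x0.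
  by rewrite ger0_norm// mulrC.
- by move=> x; rewrite mulr_ge0 ?normal_pdf_ge0.
- move=> x; apply: cvgM; last exact: norm_continuous.
  by apply: continuous_normal_pdf; rewrite oner_neq0.
- by move=> x /=; rewrite normrN !normal_pdf01 sqrrN.
Qed.
End normal_abs.

(** * Expected contraction over several steps *)

Section product_expectation.
Context {d : measure_display} {T : measurableType d} {R : realType}.
Variable P : probability T R.
Variable eps : int -> T -> R.
Hypothesis iid : iid_std_normal P eps.

Let meps : is_process eps. Proof. by case: iid. Qed.

(** A Lipschitz constant for the composition of the [m] maps applied at times n-m+1, ..., n. *)
Definition absprod (e : int -> R) (n : int) (m : nat) : R :=
  \prod_(k < m) `|e (n - k%:Z)|.

Lemma absprod_ge0 e n m : 0 <= absprod e n m.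
Proof. by apply: prodr_ge0. Qed.

Lemma measurable_absprod n m :
  measurable_fun setT (fun w => absprod (eps^~ w) n m).
Proof.
apply: measurable_prod => k _.
by apply: measurableT_comp; [exact: normr_measurable|exact: meps].
Qed.

(** Constrains the [r] noises at times n-j, n-j-1, ..., just before the times that occur in
    [absprod _ n j]. *)
Let window (B : nat -> set R) (n : int) (j r : nat) : set T :=
  [set w | forall k : 'I_r, B k (eps (n - (j + k)%N%:Z) w)].

Lemma measurable_rect (X : int -> T -> R) (r : nat) (idx : 'I_r -> int)
    (B : 'I_r -> set R) :
  is_process X -> (forall j, measurable (B j)) ->
  measurable [set w | forall j, B j (X (idx j) w)].
Proof.
move=> mX mB.
rewrite (_ : [set w | _] = \bigcap_(j in [set: 'I_r]) (X (idx j) @^-1` B j)); last first.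
  by apply/seteqP; split=> [w h j _|w h j]; [exact: h|exact: (h j)].
apply: fin_bigcap_measurable => // j _.
by rewrite -[X in measurable X]setTI; exact: mX.
Qed.

Let window_cons B n j r (B0 : set R) :
  window (fun k => if k is k'.+1 then B k' else B0) n j r.+1 =
  eps (n - j%:Z) @^-1` B0 `&` window B n j.+1 r.
Proof.
apply/seteqP; split=> w /= h.
  split; first by have := h ord0; rewrite /= addn0.
  move=> k; have := h (lift ord0 k).
  by rewrite /= /bump /= add1n addSnnS.
case: h => h0 h [[|k] hk] /=; first by rewrite addn0.
by have := h (Ordinal (hk : (k < r)%N)); rewrite /= addSnnS.
Qed.

(* Induction on j: ge0_integral_density turns the indicator of a constraint on
   the coordinate n - j into the factor |eps (n - j)|. *)
Let integral_window (rho : R) :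
  0 <= rho -> (\int[normal_prob (0:R) 1]_x `|x|%:E = rho%:E)%E ->
  forall j n r (B : nat -> set R), (forall k, measurable (B k)) ->
  (\int[P]_(w in window B n j r) (absprod (eps^~ w) n j)%:E =
   (rho ^+ j * \prod_(k < r) fine (normal_prob 0 1 (B k)))%:E)%E.
Proof.
move=> rho0 rhoE; have [_ [indep law]] := iid.
have mwin B n j r : (forall k, measurable (B k)) -> measurable (window B n j r).
  by move=> mB; apply: (measurable_rect eps r (fun k => n - (j + k)%N%:Z) (fun k => B k)).
elim=> [n r B mB|j ih n r B mB].
  under eq_integral do rewrite /absprod big_ord0.
  rewrite integral_cst//; last exact: mwin.
  rewrite mul1e expr0 mul1r.
  etransitivity.
    apply: (indep r (fun k => n - (0 + k)%N%:Z) (fun k => B k)) => // k l /= kl.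
    by apply: val_inj => /=; lia.
  rewrite -prodEFin; apply: eq_bigr => k _.
  by rewrite fineK; [exact: law|apply: fin_num_measure; exact: mB].
pose c := rho ^+ j * \prod_(k < r) fine (normal_prob 0 1 (B k)).
have c0 : 0 <= c.
  by rewrite mulr_ge0 ?exprn_ge0//; apply: prodr_ge0 => k _; exact: fine_ge0.
(* Weighted by [W], the noise at time n-j has law [c] times N(0,1); integrating its absolute value
   against that law then yields the factor [rho]. *)
pose W w : R := absprod (eps^~ w) n j * \1_(window B n j.+1 r) w.
have mW : measurable_fun setT W.
  apply: measurable_funM; first exact: measurable_absprod.
  by apply: measurable_indic; exact: mwin.
have WE (B0 : set R) : measurable B0 ->
   (\int[P]_(w in eps (n - j%:Z) @^-1` B0) (W w)%:E
   = mscale (NngNum c0) (normal_prob 0 1) B0)%E.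
  move=> mB0.
  rewrite integral_mkcond.
  (* The test set [B0] enters the induction hypothesis as one more constraint, at time n-j; this is
     why the number of constraints is left general. *)
  have := ih n r.+1 (fun k => if k is k'.+1 then B k' else B0).
  rewrite window_cons big_ord_recl/= integral_mkcond => ihE.
  transitivity (c%:E * normal_prob 0 1 B0)%E; last by [].
  rewrite -[normal_prob 0 1 B0]fineK ?fin_num_measure// -EFinM.
  transitivity ((rho ^+ j *
        (fine (normal_prob 0 1 B0) *
         \prod_(i < r) fine (normal_prob 0 1 (B i))))%:E); last first.
    by congr (_%:E); rewrite /c; ring.
  rewrite -ihE; last by case.
  apply: eq_integral => w _; rewrite !patchE in_setI /W indicE.
  by case: (w \in eps _ @^-1` _) => //=;
    case: (w \in window _ _ _ _); rewrite ?mulr1 ?mulr0.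
transitivity (\int[P]_w ((W w)%:E * `|eps (n - j%:Z) w|%:E))%E.
  rewrite integral_mkcond; apply: eq_integral => w _.
  rewrite patchE /W indicE /absprod big_ord_recr/=.
  by case: (w \in window _ _ _ _); rewrite ?mulr1 ?mulr0 ?mul0e// EFinM.
rewrite (@ge0_integral_density _ _ _ _ _ P (mscale (NngNum c0) (normal_prob 0 1)) _ W
  (meps _) mW _ WE (fun x : R => `|x|%:E)); last 3 first.
- by move=> w; rewrite mulr_ge0 ?absprod_ge0.
- by apply/measurable_EFinP; exact: normr_measurable.
- by [].
rewrite ge0_integral_mscale//; last by apply/measurable_EFinP; exact: normr_measurable.
by rewrite rhoE -EFinM/= exprS /c; congr (_%:E); ring.
Qed.

Lemma expectation_absprod (rho : R) :
  0 <= rho -> (\int[normal_prob (0:R) 1]_x `|x|%:E = rho%:E)%E ->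
  forall n m, (\int[P]_w (absprod (eps^~ w) n m)%:E = (rho ^+ m)%:E)%E.
Proof.
move=> rho0 rhoE n m.
have := integral_window rho rho0 rhoE m n 0 (fun=> setT) (fun=> measurableT).
rewrite big_ord0 mulr1 => <-; congr (integral _ _ _).
by apply/seteqP; split=> // w _ [].
Qed.

(** Markov's inequality for the product, whose mean is [rho ^+ m]. *)
Lemma probability_absprod (rho a : R) :
  0 <= rho -> (\int[normal_prob (0:R) 1]_x `|x|%:E = rho%:E)%E -> 0 < a ->
  forall n m, (P [set w | (a <= absprod (eps^~ w) n m)%R] <= (rho ^+ m / a)%:E)%E.
Proof.
move=> rho0 rhoE a0 n m.
rewrite EFinM -(expectation_absprod rho rho0 rhoE n m) lee_pdivlMr//.
have mZ : measurable_fun setT (fun w => (absprod (eps^~ w) n m)%:E).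
  by apply/measurable_EFinP; exact: measurable_absprod.
have /= := @le_integral_comp_abse _ _ _ P _ measurableT _ a id
  (@measurable_id _ _ _) (fun=> id) (in2W (fun _ _ => id)) mZ a0.
rewrite setTI muleC.
under eq_integral do rewrite ger0_norm ?absprod_ge0//.
rewrite (_ : [set x | _] = [set w | (a <= absprod (eps^~ w) n m)%R])//.
by apply/seteqP; split=> w /=; rewrite lee_fin ger0_norm ?absprod_ge0.
Qed.
End product_expectation.

(** * Joint laws of independent pairs *)

Section joint_law.
Context d1 d2 d (T : measurableType d) (T1 : measurableType d1)
  (T2 : measurableType d2) (R : realType) (P : probability T R).

(** Both joint laws agree on rectangles with the product of the marginals of [X] and [Y], and
    rectangles determine the product measure. *)
Lemma distribution_pair (X X' : {mfun T >-> T1}) (Y Y' : {mfun T >-> T2}) :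
  (forall A, measurable A -> P (X @^-1` A) = P (X' @^-1` A)) ->
  (forall B, measurable B -> P (Y @^-1` B) = P (Y' @^-1` B)) ->
  (forall A B, measurable A -> measurable B ->
    P (X @^-1` A `&` Y @^-1` B) = (P (X @^-1` A) * P (Y @^-1` B))%E) ->
  (forall A B, measurable A -> measurable B ->
    P (X' @^-1` A `&` Y' @^-1` B) = (P (X' @^-1` A) * P (Y' @^-1` B))%E) ->
  forall C, measurable C ->
  P ((fun w => (X w, Y w)) @^-1` C) = P ((fun w => (X' w, Y' w)) @^-1` C).
Proof.
move=> XX' YY' XY X'Y' C mC.
have mpair (Z1 : {mfun T >-> T1}) (Z2 : {mfun T >-> T2}) :
    measurable_fun setT (fun w => (Z1 w, Z2 w)).
  exact: measurable_fun_pair.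
have main (Z1 : {mfun T >-> T1}) (Z2 : {mfun T >-> T2}) :
    (forall A B, measurable A -> measurable B ->
      P (Z1 @^-1` A `&` Z2 @^-1` B) = (P (X @^-1` A) * P (Y @^-1` B))%E) ->
    (distribution P X \x distribution P Y)%E C =
    P ((fun w => (Z1 w, Z2 w)) @^-1` C).
  move=> Z12.
  pose mZ := isMeasurableFun.Build _ _ _ _ _ (mpair Z1 Z2).
  pose Z : {mfun T >-> (T1 * T2)%type} := HB.pack (fun w => (Z1 w, Z2 w)) mZ.
  exact: (@product_measure_unique _ _ _ _ _ (distribution P X) (distribution P Y)
    (distribution P Z) Z12 C mC).
rewrite -(main X Y)// -(main X' Y')// => A B mA mB.
by rewrite X'Y'// XX'// YY'.
Qed.
End joint_law.

(** * Path space and the law of a process *)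

Section path_space.
Context {R : realType}.

Local Notation path_space := (g_sigma_algebraType (@cylinders R)).

Lemma measurable_coordinate (i : int) :
  measurable_fun setT (fun f : path_space => f i).
Proof.
move=> _ B mB; rewrite setTI; apply: sub_sigma_algebra.
by exists i, B.
Qed.

Context {d : measure_display} {T : measurableType d} (P : probability T R).
Implicit Types X Y : int -> T -> R.

Lemma measurable_path X :
  is_process X -> measurable_fun setT (fun w => X^~ w : path_space).
Proof.
move=> mX; apply: (@measurability _ _ T path_space setT _ cylinders erefl).
by move=> _ [_ [i [B [mB ->]]] <-]; exact: mX.
Qed.

Definition path_mfun X (mX : is_process X) : {mfun T >-> path_space} :=
  HB.pack (fun w => X^~ w : path_space)
    (isMeasurableFun.Build _ _ _ _ _ (measurable_path X mX)).

(* Only injective idx are tested, so that mutual independence applies. *)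
Lemma path_law_unique X Y : is_process X -> is_process Y ->
  (forall n (idx : 'I_n -> int) (B : 'I_n -> set R), injective idx ->
    (forall j, measurable (B j)) ->
    P [set w | forall j, B j (X (idx j) w)] =
    P [set w | forall j, B j (Y (idx j) w)]) ->
  forall C : set path_space, measurable C ->
  P ((fun w => X^~ w) @^-1` C) = P ((fun w => Y^~ w) @^-1` C).
Proof.
move=> mX mY XY.
(* [G] consists of the finite-dimensional rectangles: a family closed under intersection that
   generates the cylinder sigma-algebra. *)
pose G : set (set path_space) := [set A | exists (s : seq int) (B : int -> set R),
  (forall i, measurable (B i)) /\ A = [set f | forall i, i \in s -> B i (f i)]].
have mG : G `<=` measurable.
  move=> _ [s [B [mB ->]]].
  rewrite (_ : [set f | _] =
      \bigcap_(i in [set` s]) (fun f : path_space => f i) @^-1` B i).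
    apply: fin_bigcap_measurable => // i _.
    by rewrite -[X in measurable X]setTI; exact: measurable_coordinate.
  by apply/seteqP; split.
have GT : G setT.
  by exists [::], (fun=> setT); split => //; apply/seteqP; split.
have GI : setI_closed G.
  move=> _ _ [s [B [mB ->]]] [s' [B' [mB' ->]]].
  exists (s ++ s'), (fun i => (if i \in s then B i else setT) `&`
                              (if i \in s' then B' i else setT)); split.
    by move=> i; apply: measurableI; case: ifP.
  apply/seteqP; split=> [f [/= h h'] i _|f /= h].
    by split; case: ifPn => // ?; [exact: h|exact: h'].
  by split=> i si; have := h i; rewrite mem_cat si ?orbT => /(_ isT) [].
have XYG A : G A -> P ((fun w => X^~ w) @^-1` A) = P ((fun w => Y^~ w) @^-1` A).
  move=> [s [B [mB ->]]].
  (* Removing duplicates from [s] makes the enumeration of its times injective, as the hypothesis on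
     rectangles requires. *)
  have rectE (Z : int -> T -> R) :
      (fun w => Z^~ w) @^-1` [set f | forall i, i \in s -> B i (f i)] =
      [set w | forall j : 'I_(size (undup s)),
        B (nth 0 (undup s) j) (Z (nth 0 (undup s) j) w)].
    apply/seteqP; split=> w /= h.
      by move=> j; apply: h; rewrite -mem_undup mem_nth.
    move=> i; rewrite -mem_undup => si.
    have := h (Ordinal (etrans (index_mem i _) si)).
    by rewrite /= nth_index.
  rewrite !rectE; apply: (XY _ (fun j => nth 0 (undup s) j)
    (fun j => B (nth 0 (undup s) j))) => // i j /eqP.
  by rewrite nth_uniq ?undup_uniq// => /eqP; exact: val_inj.
move=> C mC.
apply: (@g_sigma_algebra_measure_unique _ _ _ G mG (fun=> setT) _ _
  (distribution P (path_mfun X mX)) (distribution P (path_mfun Y mY))) => //.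
- by rewrite bigcup_const.
- by move=> k; rewrite [X in (X < _)%E]probability_setT ltry.
- move: C mC; apply: smallest_sub; first exact: smallest_sigma_algebra.
  move=> _ [i [B [mB ->]]]; apply: sub_sigma_algebra.
  exists [:: i], (fun=> B); split => //.
  apply/seteqP; split=> [f /= h j|f /= h]; last by apply: h; rewrite mem_head.
  by rewrite inE => /eqP ->.
Qed.
End path_space.

(** * Translation invariance of the driving sequences *)

Section stationarity.
Context {d : measure_display} {T : measurableType d} {R : realType}.
Variable P : probability T R.
Local Notation path_space := (g_sigma_algebraType (@cylinders R)).
Variables eps En : int -> T -> R.
Hypotheses (iid : iid_std_normal P eps) (mEn : is_process En).
Hypotheses (statEn : stationary P En) (indep : independent_processes P En eps).

Definition translate (k : int) (f : int -> R) : int -> R := fun i => f (i + k).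

Lemma translateD k l f : translate k (translate l f) = translate (k + l) f.
Proof. by apply/funext => i; rewrite /translate addrA. Qed.

Lemma measurable_translate k :
  measurable_fun setT (translate k : path_space -> path_space).
Proof.
apply: (@measurable_path _ _ path_space (fun i f => f (i + k))) => i.
exact: measurable_coordinate.
Qed.

(** Each marginal path law is invariant, by stationarity of [En] and by the i.i.d. property of
    [eps]; independence lifts this to the pair. *)
Lemma joint_law_translate (k : int) (C : set (path_space * path_space)) :
  measurable C ->
  P ((fun w => (En^~ w, eps^~ w)) @^-1` C) =
  P ((fun w => (translate k (En^~ w), translate k (eps^~ w))) @^-1` C).
Proof.
have [meps [meps_indep law]] := iid.
pose Enk i := En (i + k); pose epsk i := eps (i + k).
have mEnk : is_process Enk by move=> i; exact: mEn.
have mepsk : is_process epsk by move=> i; exact: meps.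
(* Pulling events back along the translation reduces independence of the translated paths to that of
   the original ones. *)
have mtr (A : set path_space) : measurable A -> prod_measurable (translate k @^-1` A).
  by move=> mA; rewrite -[X in prod_measurable X]setTI; exact: measurable_translate.
have lawEn A : measurable A ->
    P (path_mfun En mEn @^-1` A) = P (path_mfun Enk mEnk @^-1` A).
  apply: path_law_unique => // n idx B _ mB; exact: statEn.
have laweps A : measurable A ->
    P (path_mfun eps meps @^-1` A) = P (path_mfun epsk mepsk @^-1` A).
  apply: path_law_unique => // n idx B idx_inj mB.
  rewrite meps_indep//.
  rewrite (meps_indep n (fun j => idx j + k) B)//; last first.
    by move=> i j /addIr; exact: idx_inj.
  by apply: eq_bigr => j _; rewrite !law.
apply: (@distribution_pair _ _ _ _ _ _ _ P (path_mfun En mEn) (path_mfun Enk mEnk)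
  (path_mfun eps meps) (path_mfun epsk mepsk)) => // A B mA mB.
exact: (indep _ _ (mtr A mA) (mtr B mB)).
Qed.

(** A rectangle event for the new process is a single event [C] of the joint path. Since
    translations compose, shifting all its times by [k] amounts to translating the joint path by
    [k]. *)
Lemma stationary_functional (F : path_space * path_space -> R) :
  measurable_fun setT F ->
  stationary P (fun n w => F (translate n (En^~ w), translate n (eps^~ w))).
Proof.
move=> mF n idx B k mB.
pose C : set (path_space * path_space) :=
  [set x | forall j, B j (F (translate (idx j) x.1, translate (idx j) x.2))].
have mC : measurable C.
  apply: (measurable_rect (fun i (x : path_space * path_space) =>
    F (translate i x.1, translate i x.2)) n idx B) => // i.
  apply: (measurableT_comp mF); apply: measurable_fun_pair.
    exact: (measurableT_comp (measurable_translate i) measurable_fst).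
  exact: (measurableT_comp (measurable_translate i) measurable_snd).
have := joint_law_translate k C mC.
rewrite /C /preimage/=.
by under [X in _ = P X]eq_set do under eq_forall do rewrite !translateD.
Qed.
End stationarity.

(** * Convergence of the backward iterations *)

Section backward_iteration.
Context {R : realType}.
Implicit Types (e a : int -> R) (n : int) (m : nat).

(** The state at time [n] of the recurrence started from 0 at time n-m. *)
Fixpoint backward e a m n : R :=
  if m is m'.+1 then e n * `|backward e a m' (n - 1)| + a n else 0.

Lemma backward_translate l e a m n :
  backward (translate l e) (translate l a) m n = backward e a m (n + l).
Proof.
elim: m n => //= m ih n.
by rewrite ih /translate addrAC.
Qed.

Lemma absprodS e n m : absprod e n m.+1 = `|e n| * absprod e (n - 1) m.
Proof.
rewrite /absprod big_ord_recl/= subr0; congr (_ * _).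
by apply: eq_bigr => k _; congr (`|e _|); rewrite /bump/=; lia.
Qed.

(** The two runs share their last [m] maps; at time n-m one of them is at a(n-m) and the other at
    0. *)
Lemma backward_step e a m n :
  `|backward e a m.+1 n - backward e a m n| <= absprod e n m * `|a (n - m%:Z)|.
Proof.
elim: m n => [|m ih] n.
  by rewrite /= normr0 mulr0 add0r subr0 /absprod big_ord0 mul1r subr0.
have -> : backward e a m.+2 n - backward e a m.+1 n =
    e n * (`|backward e a m.+1 (n - 1)| - `|backward e a m (n - 1)|).
  by rewrite /=; ring.
rewrite normrM absprodS -mulrA ler_wpM2l//.
rewrite (le_trans (ler_dist_dist _ _))// (le_trans (ih _))//.
by rewrite (_ : n - 1 - m%:Z = n - m.+1%:Z)//; lia.
Qed.

Lemma cvgn_backward (b : R) e a n : 1 < b ->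
  (\forall m \near \oo, absprod e n m <= b ^- (2 * m)
                        /\ `|a (n - m%:Z)| <= b ^+ m) ->
  cvgn (fun m => backward e a m n).
Proof.
move=> b1 [N _ bound].
have b0 : 0 < b by exact: lt_trans b1.
(* Dropping the first [N] terms makes the bounds hold at every index; each increment is then at most
   b^(-2(m+N)) b^(m+N) = b^(-N) b^(-m), a geometric term. *)
pose v m := backward e a (m + N) n.
suff /cvg_ex[l vl] : cvgn v.
  by apply/cvg_ex; exists l; rewrite -(cvg_shiftn N).
have tv : cvgn (series (telescope v)).
  apply: normed_cvg; apply: (@series_le_cvg _ _ (geometric (b ^- N) b^-1)) => //.
  - by move=> m /=.
  - by move=> m; rewrite /= mulr_ge0 ?exprn_ge0 ?invr_ge0 ?exprn_ge0 ?ltW.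
  - move=> m; rewrite -[leLHS]/(`|v m.+1 - v m|) -[leRHS]/(b ^- N * b^-1 ^+ m).
    rewrite /v addSn (le_trans (backward_step _ _ _ _))//.
    have [h1 h2] := bound (m + N)%N (leq_addl _ _).
    rewrite (le_trans (ler_pM _ _ h1 h2))// ?absprod_ge0//.
    rewrite exprVn -invfM -exprD addnC mul2n -addnn exprD invfM -mulrA.
    by rewrite mulVf ?mulr1// expf_neq0// gt_eqF.
  - by apply: is_cvg_geometric_series; rewrite ger0_norm ?invr_ge0 ?ltW// invf_lt1.
have -> : v = (fun m => series (telescope v) m + v 0%N).
  by apply/funext => m; rewrite telescopeK/= subrK.
by apply: is_cvgD => //; exact: is_cvg_cst.
Qed.

Lemma limn_backward_rec e a n :
  cvgn (fun m => backward e a m n) -> cvgn (fun m => backward e a m (n + 1)) ->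
  limn (fun m => backward e a m (n + 1)) =
  e (n + 1) * `|limn (fun m => backward e a m n)| + a (n + 1).
Proof.
move=> cn cn1; apply/cvg_lim => //.
rewrite -(cvg_shiftS (fun m => backward e a m (n + 1)))/=.
rewrite addrK; apply: cvgD; last exact: cvg_cst.
by apply: cvgM; [exact: cvg_cst|exact: cvg_norm].
Qed.

(* limn_esup makes the functional measurable on all of path space, including
   the paths along which the iteration diverges. *)
Definition stationary_value (x : (int -> R) * (int -> R)) : R :=
  fine (limn_esup (fun m => (backward x.2 x.1 m 0)%:E)).

(** Along translated paths, iterating up to time 0 is iterating up to time [n], and upper limit and
    limit agree under convergence. *)
Lemma stationary_valueE e a n : cvgn (fun m => backward e a m n) ->
  stationary_value (translate n a, translate n e) =
  limn (fun m => backward e a m n).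
Proof.
move=> cn; rewrite /stationary_value/=.
under eq_fun do rewrite backward_translate add0r.
rewrite is_cvg_limn_esupE; last first.
  by apply: cvgP (limn (fun m => backward e a m n))%:E _;
    apply: cvg_EFin => //; exact: nearW.
by rewrite EFin_lim.
Qed.

Lemma measurable_stationary_value :
  measurable_fun [set: g_sigma_algebraType (@cylinders R)
                       * g_sigma_algebraType (@cylinders R)] stationary_value.
Proof.
apply: (measurableT_comp (@fine_measurable R setT measurableT)).
apply: (@measurable_fun_limn_esup _ _ R setT
  (fun m (x : g_sigma_algebraType (@cylinders R) * g_sigma_algebraType (@cylinders R)) =>
     (backward x.2 x.1 m 0)%:E)) => m; apply/measurable_EFinP => /=.
elim: m 0 => [n|m ih n] /=; first exact: measurable_cst.
apply: measurable_funD.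
  apply: measurable_funM.
    exact: (measurableT_comp (measurable_coordinate n) measurable_snd).
  by apply: measurableT_comp; [exact: normr_measurable|exact: ih].
exact: (measurableT_comp (measurable_coordinate n) measurable_fst).
Qed.

End backward_iteration.

(** * Borel-Cantelli and tail sums *)

Section borel_cantelli.
Context {d : measure_display} {T : measurableType d} {R : realType}.
Variable P : probability T R.

(** Bounded partial sums make the series of probabilities converge, so the upper limit of the events
    is null by Borel-Cantelli. *)
Lemma ae_near_notin (F : nat -> set T) (K : R) :
  (forall m, measurable (F m)) ->
  (forall N, (\sum_(0 <= m < N) P (F m) <= K%:E)%E) ->
  {ae P, forall w, \forall m \near \oo, ~ F m w}.
Proof.
move=> mF FK; exists (lim_sup_set F); split.
- by apply: bigcap_measurable => // n _; exact: bigcup_measurable.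
- apply: lim_sup_set_cvg0 => //; apply: (@le_lt_trans _ _ K%:E); last exact: ltry.
  by apply: lime_le; [exact: is_cvg_nneseries|exact: nearW].
- move=> w /= nw n _; apply: contrapT => nF; apply: nw.
  exists n => // m /= nm Fm; apply: nF; by exists m.
Qed.

Lemma measurable_superlevel (Z : T -> R) (a : R) :
  measurable_fun setT Z -> measurable [set w | a < Z w].
Proof.
move=> mZ; rewrite (_ : [set w | _] = setT `&` Z @^-1` `]a, +oo[); first exact: mZ.
by rewrite setTI; apply/seteqP; split=> w /=; rewrite in_itv/= andbT.
Qed.

Lemma count_multiples_lt (c z : R) (N : nat) : 0 < c -> 0 <= z ->
  \sum_(0 <= m < N) ((m%:R * c < z)%R : nat)%:R <= z / c + 1 :> R.
Proof.
move=> c0 z0.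
(* The bound by [N] closes the induction: if N c < z, the count so far is at most N <= z / c, which
   leaves room for one more. *)
suff: \sum_(0 <= m < N) ((m%:R * c < z)%R : nat)%:R <= Num.min (z / c + 1) N%:R :> R.
  by rewrite le_min => /andP[].
elim: N => [|N ih].
  by rewrite big_nil le_min lexx andbT addr_ge0// divr_ge0// ltW.
rewrite big_nat_recr//=; move: ih; rewrite !le_min => /andP[ih1 ih2].
case: (ltP (N%:R * c) z) => [h|_] /=; last first.
  by rewrite addr0 ih1/= (le_trans ih2)// ler_nat.
apply/andP; split.
  by apply: lerD; rewrite // (le_trans ih2)// ler_pdivlMr// ltW.
by rewrite -[N.+1%:R]natr1; apply: lerD.
Qed.

(** The pointwise count of multiples of [c] below [Z], integrated: a finite mean gives summable
    tails. *)
Lemma sum_probability_multiples_lt (Z : T -> R) (c : R) (N : nat) :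
  measurable_fun setT Z -> (forall w, 0 <= Z w) -> 0 < c ->
  (\sum_(0 <= m < N) P [set w | (m%:R * c < Z w)%R] <=
   (\int[P]_w (Z w)%:E) * c^-1%:E + 1)%E.
Proof.
move=> mZ Z0 c0.
have mS m : measurable [set w | (m%:R * c < Z w)%R] by exact: measurable_superlevel.
have PE m : P [set w | (m%:R * c < Z w)%R] =
    (\int[P]_w (\1_[set w | (m%:R * c < Z w)%R] w)%:E)%E.
  by rewrite integral_indic// setIT.
under eq_bigr do rewrite PE.
rewrite -ge0_integral_sum//; last first.
  by move=> m; apply/measurable_EFinP; exact: measurable_indic.
rewrite -ge0_integralZr//; last 3 first.
  exact/measurable_EFinP.
  by move=> w _; rewrite lee_fin.
  by rewrite lee_fin invr_ge0 ltW.
have <- : (\int[P]_(w in setT) (cst 1 w) = 1 :> \bar R)%E.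
  rewrite integral_cst// mul1e; exact: probability_setT.
rewrite -ge0_integralD//; last 2 first.
  by move=> w _; rewrite -EFinM lee_fin divr_ge0// ltW.
  by apply: emeasurable_funM => //; exact/measurable_EFinP.
apply: ge0_le_integral => //.
- by move=> w _; rewrite sume_ge0.
- by apply: emeasurable_sum => m; apply/measurable_EFinP; exact: measurable_indic.
- by apply: emeasurable_funD => //; apply: emeasurable_funM => //; exact/measurable_EFinP.
move=> w _; rewrite sumEFin -EFinM -EFinD lee_fin.
under eq_bigr do rewrite indicE mem_setE.
exact: count_multiples_lt.
Qed.
End borel_cantelli.

(** * Almost sure convergence and uniqueness *)

Section stationary_solutions.
Context {d : measure_display} {T : measurableType d} {R : realType}.
Variable P : probability T R.
Implicit Types (X Y : int -> T -> R).

Lemma ae_forall_int (Q : int -> T -> Prop) :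
  (forall n, {ae P, forall w, Q n w}) -> {ae P, forall w, forall n, Q n w}.
Proof.
move=> aeQ.
have /= aeP := ae_foralln (fun n => aeQ (Posz n)).
have /= aeN := ae_foralln (fun n => aeQ (Negz n)).
by apply: filterS2 aeP aeN => w QP QN [] n; [exact: QP|exact: QN].
Qed.

Lemma stationary_marginal X (n : int) (B : set R) :
  stationary P X -> measurable B ->
  P [set w | B (X n w)] = P [set w | B (X 0 w)].
Proof.
move=> statX mB.
have := statX 1%N (fun=> 0) (fun=> B) n (fun=> mB).
rewrite add0r (_ : [set w | _] = [set w | B (X 0 w)]); last first.
  by apply/seteqP; split=> w /= h; [exact: h ord0|].
rewrite [X in _ = P X](_ : _ = [set w | B (X n w)])//.
by apply/seteqP; split=> w /= h; [exact: h ord0|].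
Qed.

Lemma tightness (Z : T -> R) (e : R) : measurable_fun setT Z -> 0 < e ->
  \forall K \near \oo, (P [set w | (K%:R < Z w)%R] <= e%:E)%E.
Proof.
move=> mZ e0; pose F K := [set w | K%:R < Z w].
have mF K : measurable (F K) by exact: measurable_superlevel.
have : P (F K) @[K --> \oo] --> 0%E.
  rewrite -(measure0 P) (_ : set0 = \bigcap_K F K).
    apply: nonincreasing_cvg_mu => //.
    - by rewrite (le_lt_trans (probability_le1 P _)) ?ltry.
    - exact: bigcapT_measurable.
    - move=> K L KL; apply/subsetPset => w; apply: le_lt_trans.
      by rewrite ler_nat.
  apply/seteqP; split=> // w /(_ (Num.trunc (Z w)).+1 Logic.I).
  by rewrite /F/= ltNge => /negP; apply; apply: ltW; exact: truncnS_gt.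
move=> /fine_cvg/cvgr0_norm_lt/(_ _ e0).
apply: filterS => K; rewrite ger0_norm ?fine_ge0// => /ltW FK.
by rewrite -(fineK (fin_num_measure P _ (mF K))) lee_fin.
Qed.

Lemma measurable_logplus : measurable_fun [set: R] logplus.
Proof.
rewrite (_ : logplus = fun x => ln (Num.max 1 x)).
  apply: measurableT_comp; first exact: measurable_ln.
  exact: measurable_maxr.
by apply/funext => x; rewrite /logplus; case: ltP; rewrite ?ln1.
Qed.

Lemma logplus_ge0 (x : R) : 0 <= logplus x.
Proof. by rewrite /logplus; case: ifPn => // /ltW; exact: ln_ge0. Qed.

Variables eps En : int -> T -> R.
Hypothesis iid : iid_std_normal P eps.

Lemma measurable_absprod_ge (a : R) n m :
  measurable [set w | a <= absprod (eps^~ w) n m].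
Proof.
rewrite (_ : [set w | _] = setT `&` (fun w => absprod (eps^~ w) n m) @^-1` `[a, +oo[).
  exact: (measurable_absprod P eps iid).
by rewrite setTI; apply/seteqP; split=> w /=; rewrite in_itv/= andbT.
Qed.

Lemma contraction_rate (rho : R) : 0 < rho -> rho < 1 ->
  exists2 b, 1 < b & rho * b ^+ 2 < 1.
Proof.
move=> rho0 rho1; exists (2 / (1 + rho)).
  by rewrite ltr_pdivlMr; lra.
rewrite expr_div_n mulrA ltr_pdivrMr; last by rewrite exprn_gt0; lra.
have : 0 < (1 - rho) ^+ 2 by rewrite exprn_gt0; lra.
by rewrite !expr2; nra.
Qed.

Lemma ae_cvgn_backward : is_process En -> stationary P En ->
  (\int[P]_w (logplus `|En 0 w|)%:E < +oo)%E ->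
  {ae P, forall w, forall n,
    cvgn (fun m => backward (eps^~ w) (En^~ w) m n)}.
Proof.
move=> mEn statEn log_int; apply: ae_forall_int => n.
have [rho /andP[rho0 rho1] rhoE] := @integral_normal_abs R.
have [b b1 q1] := contraction_rate rho rho0 rho1.
have b0 : 0 < b by exact: lt_trans b1.
pose q := rho * b ^+ 2; rewrite -/q in q1.
have q0 : 0 <= q by rewrite mulr_ge0 ?exprn_ge0 ?ltW.
(* Markov's inequality at level b^(-2m) gives probability at most q^m, a summable bound. *)
have prod_small : {ae P, forall w, \forall m \near \oo,
    ~ b ^- (2 * m) <= absprod (eps^~ w) n m}.
  apply: (ae_near_notin P (fun m => [set w | b ^- (2 * m) <= absprod (eps^~ w) n m])
    (1 - q)^-1).
    by move=> m; exact: measurable_absprod_ge.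
  move=> N; apply: (@le_trans _ _ (\sum_(0 <= m < N) (q ^+ m)%:E)%E).
    apply: lee_sum => m _.
    apply: (le_trans (probability_absprod P eps iid rho (b ^- (2 * m))
      (ltW rho0) rhoE _ n m)).
      by rewrite invr_gt0 exprn_gt0.
    by rewrite lee_fin invrK exprM -exprMn.
  rewrite sumEFin lee_fin.
  have := congr1 (fun u : R^nat => u N) (geometric_seriesE 1 (negbT (lt_eqF q1))).
  rewrite seriesEnat/=; under eq_bigr do rewrite /= mul1r.
  have h : 0 <= (1 - q)^-1 by rewrite invr_ge0 subr_ge0 ltW.
  move=> ->; rewrite mul1r ler_piMl//.
  by rewrite lerBlDr lerDl exprn_ge0.
(* By stationarity En(n-m) may be replaced by En(0), and b^m < |En(0)| forces m ln b < [Z]; the tail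
   sum bound then applies. *)
have En_small : {ae P, forall w, \forall m \near \oo,
    ~ b ^+ m < `|En (n - m%:Z) w|}.
  pose Z w := logplus `|En 0 w|.
  have lnb0 : 0 < ln b by rewrite ln_gt0.
  have mZ : measurable_fun setT Z.
    apply: (measurableT_comp measurable_logplus).
    by apply: measurableT_comp; [exact: normr_measurable|exact: mEn].
  have Z0 w : 0 <= Z w by exact: logplus_ge0.
  have EZ : (\int[P]_w (Z w)%:E \is a fin_num)%E.
    by rewrite ge0_fin_numE// integral_ge0// => w _; rewrite lee_fin.
  apply: (ae_near_notin P (fun m => [set w | b ^+ m < `|En (n - m%:Z) w|])
    (fine (\int[P]_w (Z w)%:E) * (ln b)^-1 + 1)).
    move=> m; apply: measurable_superlevel.
    by apply: measurableT_comp; [exact: normr_measurable|exact: mEn].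
  move=> N; rewrite EFinD EFinM fineK//.
  apply: le_trans (sum_probability_multiples_lt P Z (ln b) N mZ Z0 lnb0).
  apply: lee_sum => m _.
  have mB : measurable [set x : R | b ^+ m < `|x|].
    by apply: measurable_superlevel; exact: normr_measurable.
  rewrite (stationary_marginal En (n - m%:Z) _ statEn mB).
  apply: le_measure; rewrite ?inE.
  - apply: measurable_superlevel.
    by apply: measurableT_comp; [exact: normr_measurable|exact: mEn].
  - exact: measurable_superlevel.
  - move=> w /= h.
    have h1 : 1 < `|En 0 w| by apply: le_lt_trans h; rewrite exprn_ege1// ltW.
    rewrite /Z /logplus h1 mulr_natl -lnXn// ltr_ln// posrE ?exprn_gt0//.
    exact: lt_trans h1.
apply: filterS2 prod_small En_small => w h1 h2.
apply: (cvgn_backward b _ _ _ b1).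
by apply: filterS2 h1 h2 => m /negP h /negP h'; split;
  [rewrite ltW// ltNge|rewrite leNgt].
Qed.

(** The additive terms cancel and the absolute value is 1-Lipschitz, so each step back in time costs
    one factor of [absprod]. *)
Lemma contraction (e a x y : int -> R) :
  (forall n, x (n + 1) = e (n + 1) * `|x n| + a (n + 1)) ->
  (forall n, y (n + 1) = e (n + 1) * `|y n| + a (n + 1)) ->
  forall m n, `|y n - x n| <= absprod e n m * `|y (n - m%:Z) - x (n - m%:Z)|.
Proof.
move=> xrec yrec; elim=> [n|m ih n].
  by rewrite /absprod big_ord0 mul1r subr0.
have -> : y n - x n = e n * (`|y (n - 1)| - `|x (n - 1)|).
  by have := xrec (n - 1); have := yrec (n - 1); rewrite subrK => -> ->; ring.
rewrite normrM absprodS -mulrA ler_wpM2l//.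
rewrite (le_trans (ler_dist_dist _ _))// (le_trans (ih _))//.
by rewrite (_ : n - 1 - m%:Z = n - m.+1%:Z)//; lia.
Qed.

Lemma stationary_solution_unique X Y :
  stationary_solution P eps En X -> stationary_solution P eps En Y ->
  {ae P, forall w, forall n, Y n w = X n w}.
Proof.
move=> [mX [statX Xrec]] [mY [statY Yrec]]; apply: ae_forall_int => n.
have [rho /andP[rho0 rho1] rhoE] := @integral_normal_abs R.
pose D w := `|Y n w - X n w|.
have mabs (Z : int -> T -> R) k : is_process Z -> measurable_fun setT (fun w => `|Z k w|).
  by move=> mZ; apply: measurableT_comp; [exact: normr_measurable|exact: mZ].
have mD : measurable_fun setT D.
  apply: measurableT_comp; first exact: normr_measurable.
  by apply: measurable_funB; [exact: mY|exact: mX].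
have D0 delta : 0 < delta -> P [set w | delta < D w] = 0%E.
  move=> delta0; apply/eqP; rewrite -measure_le0; apply/lee_addgt0Pr => e e0.
  rewrite add0e.
  have e3 : 0 < e / 3 by rewrite divr_gt0.
  (* [K] is fixed at time 0 before [m] is chosen; stationarity carries the same bound to time n-m
     for every [m]. *)
  have [K [K0 [YK XK]]] : exists K : nat, (0 < K)%N /\
      ((P [set w | (K%:R < `|Y 0 w|)%R] <= (e / 3)%:E)%E /\
      (P [set w | (K%:R < `|X 0 w|)%R] <= (e / 3)%:E)%E).
    have tY := tightness _ _ (mabs Y 0 mY) e3.
    have tX := tightness _ _ (mabs X 0 mX) e3.
    have [K _ /(_ K (leqnn K))] := filterI (nbhs_infty_gt 0) (filterI tY tX).
    by exists K.
  (* If both solutions are at most [K] in absolute value at time n-m and the product is below [a],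
     the distance at time [n] is at most a (K + K) = [delta]. *)
  pose a := delta / (2 * K%:R).
  have a0 : 0 < a by rewrite divr_gt0// mulr_gt0// ltr0n.
  have [m rhom] : exists m, rho ^+ m / a <= e / 3.
    have ea0 : 0 < e / 3 * a by rewrite mulr_gt0.
    have : rho ^+ m @[m --> \oo] --> 0 by apply: cvg_expr; rewrite ger0_norm// ltW.
    move=> /cvgr0_norm_lt/(_ _ ea0)[m _ /(_ m (leqnn m))] /=.
    rewrite ger0_norm ?exprn_ge0 ?ltW// => /ltW h.
    by exists m; rewrite ler_pdivrMr.
  (* Outside the null set [N] both recurrences hold at all times; the three events below each have
     probability at most e/3. *)
  have [N [mN N0 subN]] := filterI Xrec Yrec.
  pose F1 := [set w | a <= absprod (eps^~ w) n m].
  pose F2 := [set w | K%:R < `|Y (n - m%:Z) w|].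
  pose F3 := [set w | K%:R < `|X (n - m%:Z) w|].
  have mF1 : measurable F1 by exact: measurable_absprod_ge.
  have mF2 : measurable F2 by apply: measurable_superlevel; exact: mabs.
  have mF3 : measurable F3 by apply: measurable_superlevel; exact: mabs.
  have sub : [set w | delta < D w] `<=` N `|` (F1 `|` (F2 `|` F3)).
    move=> w /= dw; have [Nw|Nw] := pselect (N w); [by left|right].
    have /contrapT/= [xrec yrec] := fun h => Nw (subN w h).
    have [h1|h1] := leP a (absprod (eps^~ w) n m); [by left|right].
    have [h2|h2] := leP `|Y (n - m%:Z) w| K%:R; [right|by left].
    rewrite /F3/= ltNge; apply/negP => h3; move: dw; apply/negP; rewrite -leNgt.
    apply: (le_trans (contraction (eps^~ w) (En^~ w) (X^~ w) (Y^~ w) xrec yrec m n)).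
    have -> : delta = a * (K%:R + K%:R).
      by rewrite /a; field; rewrite pnatr_eq0 -lt0n.
    apply: ler_pM => //; [exact: absprod_ge0|exact: ltW|].
    by rewrite (le_trans (ler_normB _ _))// lerD.
  apply: (le_trans (le_measure P _ _ sub)); rewrite ?inE.
  - exact: measurable_superlevel.
  - by apply: measurableU => //; apply: measurableU => //; exact: measurableU.
  have -> : e%:E = (0 + ((e / 3)%:E + ((e / 3)%:E + (e / 3)%:E)))%E.
    by rewrite add0e -!EFinD; congr (_%:E); field.
  apply: (le_trans (measureU2 _ _ _)) => //.
    by apply: measurableU => //; exact: measurableU.
  apply: leeD; first by rewrite [leLHS]N0.
  apply: (le_trans (measureU2 _ _ _)) => //; first exact: measurableU.
  apply: leeD.
    apply: (le_trans (probability_absprod P eps iid rho a (ltW rho0) rhoE a0 n m)).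
    by rewrite lee_fin.
  apply: (le_trans (measureU2 _ _ _)) => //.
  have mK : measurable [set x : R | K%:R < `|x|].
    by apply: measurable_superlevel; exact: normr_measurable.
  apply: leeD.
    by rewrite [leLHS](stationary_marginal Y (n - m%:Z) _ statY mK).
  by rewrite [leLHS](stationary_marginal X (n - m%:Z) _ statX mK).
have : {ae P, forall w, forall k, D w <= k.+1%:R^-1}.
  apply: ae_foralln => k; exists [set w | k.+1%:R^-1 < D w]; split.
  - exact: measurable_superlevel.
  - by apply: D0; rewrite invr_gt0.
  - by move=> w /= /negP; rewrite -ltNge.
apply: filterS => w Dw; apply/eqP; rewrite -subr_eq0 -normr_le0 leNgt.
apply/negP => /ltr_add_invr[k]; rewrite add0r => /(le_lt_trans (Dw k)).
by rewrite ltxx.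
Qed.
End stationary_solutions.

(** * Existence and uniqueness of the stationary solution *)

Theorem theorem3 (d : measure_display) (T : measurableType d) (R : realType)
  (P : probability T R) (eps En : int -> T -> R) :
  iid_std_normal P eps ->
  is_process En ->
  stationary P En -> ergodic P En ->
  independent_processes P En eps ->
  (forall i : int, (\int[P]_w (logplus `|En i w|)%:E < +oo)%E) ->
  exists X : int -> T -> R,
    stationary_solution P eps En X /\
    forall Y : int -> T -> R, stationary_solution P eps En Y ->
      {ae P, forall w, forall n : int, Y n w = X n w}.
Proof.
move=> iid mEn statEn _ indep log_int; have [meps _] := iid.
(* One functional evaluated on paths translated by [n]: stationarity holds by construction, and the
   recurrence holds wherever the backward iterations converge. *)
pose X n w := stationary_value (translate n (En^~ w), translate n (eps^~ w)).
have solX : stationary_solution P eps En X.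
  split; [|split].
  - move=> n; apply: (measurableT_comp measurable_stationary_value).
    apply: measurable_fun_pair.
      exact: (measurableT_comp (measurable_translate n) (measurable_path En mEn)).
    exact: (measurableT_comp (measurable_translate n) (measurable_path eps meps)).
  - exact: (stationary_functional P eps En iid mEn statEn indep
      stationary_value measurable_stationary_value).
  - have := ae_cvgn_backward P eps En iid mEn statEn (log_int 0).
    apply: filterS => w cvg_w n.
    by rewrite /X !stationary_valueE//; exact: limn_backward_rec.
exists X; split=> // Y solY.
exact: (stationary_solution_unique P eps En iid X Y solX solY).
Qed.
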